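(* Let $\Gamma$ be a metrized graph with $v$ vertices. Then $$(v-2)\, x(\Gamma) =\sum_{e_i \in E(\Gamma)}\frac{R_i}{L_i+R_i}\,x(\overline{\Gamma}_i), \qquad (v-2)\, y(\Gamma) =\sum_{e_i \in E(\Gamma)}\frac{R_i}{L_i+R_i}\,y(\overline{\Gamma}_i).$$
   Context: A metrized graph $\Gamma$ is a finite connected graph (multiple edges and self-loops allowed) each of whose edges is identified with a closed segment of positive length, with a finite nonempty vertex set $V(\Gamma)$ containing every point of valence $\neq2$; $v=\#V(\Gamma)$, $E(\Gamma)$ its edge set, $L_i$ the length of $e_i$. For an edge $e_i$ with end points $p_i,q_i$: if $\Gamma-e_i$ (interior deleted) is connected, $R_i$ is the effective resistance between $p_i,q_i$ in $\Gamma-e_i$ (edges as resistors of resistance equal to length), $R_{a_i,p}=\hat j_{p_i}(p,q_i)$, $R_{b_i,p}=\hat j_{q_i}(p,p_i)$, with $\hat j_z(x,y)$ the voltage function of $\Gamma-e_i$ (potential at $x$ when unit current enters at $y$ and exits at $z$, potential $0$ at $z$); if $e_i$ is a bridge, $R_{a_i,p}=0,R_{b_i,p}=R_i$ for $p$ in the component of $\Gamma-e_i$ containing $p_i$ and $R_{a_i,p}=R_i,R_{b_i,p}=0$ otherwise, with every expression in $R_i$ interpreted as its limit as $R_i\to\infty$; for a self-loop $R_i=0$. For a fixed vertex $p$ (the values are independent of $p$): $$y(\Gamma)=\frac14\sum_{e_i}\frac{L_iR_i^2}{(L_i+R_i)^2}+\frac34\sum_{e_i}\frac{L_i(R_{a_i,p}-R_{b_i,p})^2}{(L_i+R_i)^2},$$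 $$x(\Gamma)=\sum_{e_i}\frac{L_i^2R_i}{(L_i+R_i)^2}+\frac34\sum_{e_i}\frac{L_iR_i^2}{(L_i+R_i)^2}-\frac34\sum_{e_i}\frac{L_i(R_{a_i,p}-R_{b_i,p})^2}{(L_i+R_i)^2}.$$ $\overline\Gamma_i$ is obtained by contracting $e_i$ to a point, vertex set the image of $V(\Gamma)$; $x(\overline\Gamma_i),y(\overline\Gamma_i)$ are computed in $\overline\Gamma_i$. *)

(* Defs.v *)
From HB Require Import structures.
From mathcomp Require Import all_boot all_order all_algebra.
From mathcomp Require Import all_classical all_reals all_analysis.
From Stdlib Require Import ClassicalEpsilon.
Set Implicit Arguments. Unset Strict Implicit. Unset Printing Implicit Defensive.
Import Order.TTheory GRing.Theory Num.Theory numFieldNormedType.Exports.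
Local Open Scope ring_scope.

(* A finite (multi)graph with metrized edges.  Vertices form a subset gV of a
   finite universe T, edges a subset gE of a finite universe E; edge e joins
   gsrc e and gtgt e (self-loops when gsrc e = gtgt e, multiple edges allowed)
   and has length glen e. *)
Record mgraph (R : realType) (T E : finType) := MGraph {
  gV : {set T};
  gE : {set E};
  gsrc : E -> T;
  gtgt : E -> T;
  glen : E -> R }.

Section Defs.
Variables (R : realType) (T E : finType).
Implicit Types (G : mgraph R T E).

Definition gadj G : rel T := fun u w =>
  [exists e in gE G, ((gsrc G e == u) && (gtgt G e == w))
                  || ((gsrc G e == w) && (gtgt G e == u))].

Definition gconnected G : bool :=
  [forall u in gV G, forall w in gV G, connect (gadj G) u w].

Definition metrized G : Prop :=
  [/\ gV G != finset.set0,
      (forall e, e \in gE G -> gsrc G e \in gV G /\ gtgt G e \in gV G),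
      (forall e, e \in gE G -> 0 < glen G e) &
      gconnected G].

Definition gdelete G (i : E) : mgraph R T E :=
  MGraph (gV G) (gE G :\ i) (gsrc G) (gtgt G) (glen G).

Definition gcontract G (i : E) : mgraph R T E :=
  let p := gsrc G i in let q := gtgt G i in
  let m := fun w => if w == q then p else w in
  MGraph (if p == q then gV G else gV G :\ q) (gE G :\ i)
         (fun e => m (gsrc G e)) (fun e => m (gtgt G e)) (glen G).

(* Kirchhoff's laws: f is the potential when a unit current enters at y and
   exits at z, with f z = 0 (edges are resistors of resistance = length). *)
Definition is_voltage G (z y : T) (f : T -> R) : Prop :=
  f z = 0 /\
  forall w, w \in gV G ->
    \sum_(e in gE G)
       (((gsrc G e == w)%:R * (f w - f (gtgt G e))
         + (gtgt G e == w)%:R * (f w - f (gsrc G e))) / glen G e)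
    = (w == y)%:R - (w == z)%:R.

Definition voltage G (z x y : T) : R :=
  epsilon (inhabits (fun _ : T => 0)) (is_voltage G z y) x.

(* effective resistance between the endpoints of e_i in Gamma - e_i *)
Definition Rres G i : R :=
  voltage (gdelete G i) (gtgt G i) (gsrc G i) (gsrc G i).
Definition Ra G i p : R := voltage (gdelete G i) (gsrc G i) p (gtgt G i).
Definition Rb G i p : R := voltage (gdelete G i) (gtgt G i) p (gsrc G i).

Definition yterm (L r d : R) : R :=
  4^-1 * (L * r ^+ 2 / (L + r) ^+ 2) + 3 / 4 * (L * d ^+ 2 / (L + r) ^+ 2).
Definition xterm (L r d : R) : R :=
  L ^+ 2 * r / (L + r) ^+ 2 + 3 / 4 * (L * r ^+ 2 / (L + r) ^+ 2)
  - 3 / 4 * (L * d ^+ 2 / (L + r) ^+ 2).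
Definition wterm (L r : R) : R := r / (L + r).

Definition is_bridge G i : bool := ~~ gconnected (gdelete G i).

(* For a bridge: R_{a_i,p} - R_{b_i,p} = 0 - R_i if p lies in the component of
   Gamma - e_i containing p_i, and R_i - 0 otherwise; the expression is then
   replaced by its limit as R_i -> +oo. *)
Definition bridge_sign G i p : R :=
  if connect (gadj (gdelete G i)) (gsrc G i) p then -1 else 1.

Definition edge_term (F : R -> R -> R -> R) G i p : R :=
  if is_bridge G i then
    lim ((F (glen G i) r (bridge_sign G i p * r) @[r --> +oo])%classic)
  else F (glen G i) (Rres G i) (Ra G i p - Rb G i p).

Definition weight G i : R :=
  if is_bridge G i then lim ((wterm (glen G i) r @[r --> +oo])%classic)
  else wterm (glen G i) (Rres G i).

Definition xp G p : R := \sum_(i in gE G) edge_term xterm G i p.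
Definition yp G p : R := \sum_(i in gE G) edge_term yterm G i p.

(* x(Gamma), y(Gamma): computed at a (any) fixed vertex p of Gamma *)
Definition xg G : R := if [pick w in gV G] is Some p then xp G p else 0.
Definition yg G : R := if [pick w in gV G] is Some p then yp G p else 0.

End Defs.

(* Main.v *)
(* Fix a ground vertex P and let g be the Green function of Gamma (Dirichlet
   problem with g = 0 at P), h_i = g(p_i, .) - g(q_i, .), r_i the effective
   resistance between p_i and q_i in Gamma itself, and f(z) = g(z, z) = r(z, P).
   In these terms R_i / (L_i + R_i) = r_i / L_i, and, with E the Dirichlet energy,
   y = 1/4 sum r_i^2 / L_i + 3/4 E(f) and x + y = sum r_i; bridges are the edges
   with r_i = L_i.  Contracting e_i replaces g by g - h_i h_i / r_i.  Expanding
   the right-hand sides, everything is summed by Foster's theorem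
   sum r_i / L_i = v - 1, by sum_i h_i^2 / L_i = f and by reciprocity, except for
   terms quartic in h_i; these are evaluated by pairing h_i with h_i^3. *)
Require Import Defs.
From HB Require Import structures.
From mathcomp Require Import all_boot all_order all_algebra.
From mathcomp Require Import all_classical all_reals all_analysis.
From mathcomp Require Import ring lra.
From Stdlib Require Import ClassicalEpsilon.
Import Order.TTheory GRing.Theory Num.Theory numFieldNormedType.Exports.
Local Open Scope ring_scope.

Set Implicit Arguments.
Unset Strict Implicit.
Unset Printing Implicit Defensive.

(** * Dirichlet form, weak form of Kirchhoff's laws, existence and uniqueness of potentials *)

Section Dirichlet.
Variables (R : realType) (T E : finType).
Implicit Types (G : mgraph R T E) (f u phi : T -> R).

Definition closed_edges G : Prop :=
  forall e, e \in gE G -> gsrc G e \in gV G /\ gtgt G e \in gV G.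

Definition pos_len G : Prop := forall e, e \in gE G -> 0 < glen G e.

Definition grad G (e : E) f : R := f (gsrc G e) - f (gtgt G e).

Definition dirichlet G f u : R :=
  \sum_(e in gE G) grad G e f * grad G e u / glen G e.

Definition laplacian G f (w : T) : R :=
  \sum_(e in gE G)
     (((gsrc G e == w)%:R * (f w - f (gtgt G e))
       + (gtgt G e == w)%:R * (f w - f (gsrc G e))) / glen G e).

Lemma sum_mul_eq (V : {set T}) (x : T) (F : T -> R) :
  x \in V -> \sum_(w in V) (x == w)%:R * F w = F x.
Proof.
move=> xV; rewrite (bigD1 x) //= eqxx mul1r big1 ?addr0 // => w /andP[_ wx].
by rewrite eq_sym (negPf wx) mul0r.
Qed.

(** Summation by parts: after exchanging the sums, an edge contributes only at its two end
    points. *)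
Lemma sum_laplacian G f phi : closed_edges G ->
  \sum_(w in gV G) phi w * laplacian G f w = dirichlet G f phi.
Proof.
move=> cl; under eq_bigr do rewrite mulr_sumr.
rewrite exchange_big /=; apply: eq_bigr => e eE.
have [sV tV] := cl _ eE.
transitivity (\sum_(w in gV G)
  ((gsrc G e == w)%:R * (phi w * (f w - f (gtgt G e)))
   + (gtgt G e == w)%:R * (phi w * (f w - f (gsrc G e)))) / glen G e).
  by apply: eq_bigr => w _; ring.
rewrite -mulr_suml big_split /= !sum_mul_eq // /grad; ring.
Qed.

Lemma laplacianE G f w :
  laplacian G f w = dirichlet G f (fun x => (x == w)%:R).
Proof.
apply: eq_bigr => e _; rewrite /grad; congr (_ / _).
by case: eqP => [->|_]; case: eqP => [->|_] /=; ring.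
Qed.

Lemma dirichletC G f u : dirichlet G f u = dirichlet G u f.
Proof. by apply: eq_bigr => e _; rewrite (mulrC (grad _ _ _)). Qed.

Lemma dirichlet_lin G f u phi (a b : R) :
  dirichlet G (fun x => a * f x + b * u x) phi
  = a * dirichlet G f phi + b * dirichlet G u phi.
Proof.
rewrite /dirichlet !mulr_sumr -big_split; apply: eq_bigr => e _ /=.
by rewrite /grad; ring.
Qed.

Lemma dirichlet_eq0 G f : pos_len G -> dirichlet G f f = 0 ->
  forall e, e \in gE G -> grad G e f = 0.
Proof.
move=> pos; rewrite /dirichlet => /psumr_eq0P h e eE.
have /eqP := h (fun e eE => divr_ge0 (sqr_ge0 (grad G e f)) (ltW (pos e eE))) e eE.
by rewrite !mulf_eq0 orbb invr_eq0 (gt_eqF (pos e eE)) orbF => /eqP.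
Qed.

Lemma dirichlet_ge0 G f : pos_len G -> 0 <= dirichlet G f f.
Proof.
move=> pos; apply: sumr_ge0 => e eE.
by rewrite divr_ge0 ?sqr_ge0 // ltW // pos.
Qed.

Lemma dirichlet_delete G i f u : i \in gE G ->
  dirichlet (gdelete G i) f u
  = dirichlet G f u - grad G i f * grad G i u / glen G i.
Proof. by move=> iE; rewrite /dirichlet (big_setD1 i iE) /= addrC addrK. Qed.

(** Weak form of Kirchhoff's laws. One direction is summation by parts, the other tests against
    indicators of vertices. *)
Lemma is_voltageP G z y f : closed_edges G -> y \in gV G -> z \in gV G ->
  is_voltage G z y f <->
  f z = 0 /\ forall phi, dirichlet G f phi = phi y - phi z.
Proof.
move=> cl yV zV; split=> -[fz h]; split=> //.
  move=> phi; rewrite -(sum_laplacian _ _ cl).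
  under eq_bigr => w wV do rewrite [laplacian _ _ _](h w wV) mulrBr mulrC (mulrC (phi w))
    (eq_sym w) (eq_sym w).
  by rewrite sumrB !sum_mul_eq.
move=> w wV; rewrite -/(laplacian G f w) laplacianE h.
by rewrite (eq_sym y) (eq_sym z).
Qed.

Lemma grad0_connect G f : (forall e, e \in gE G -> grad G e f = 0) ->
  forall x y, connect (gadj G) x y -> f x = f y.
Proof.
move=> h x y /connectP[p]; elim: p x => [|z p IH] x /=; first by move=> _ ->.
case/andP=> /existsP[e /andP[eE exz]] pz yl; rewrite -(IH z pz yl).
have /eqP := h e eE; rewrite subr_eq0 => /eqP st.
by case/orP: exz => /andP[/eqP <- /eqP <-].
Qed.

Lemma gadj_connect_sym G : connect_sym (gadj G).
Proof.
apply: sym_connect_sym => x y; apply/existsP/existsP => -[e he]; exists e;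
  by rewrite orbC.
Qed.

Lemma gconnectedP G : reflect
  (forall x y, x \in gV G -> y \in gV G -> connect (gadj G) x y) (gconnected G).
Proof.
apply: (iffP forallP) => h u.
  by move=> w uV wV; have /implyP/(_ uV)/forallP/(_ w)/implyP/(_ wV) := h u.
by apply/implyP => uV; apply/forallP => w; apply/implyP; apply: h.
Qed.

(** The difference of two solutions has zero energy, so connectivity makes it constant on vertices,
    and it vanishes at [z]. *)
Lemma voltage_unique G z y f u : closed_edges G -> pos_len G -> gconnected G ->
  y \in gV G -> z \in gV G -> is_voltage G z y f -> is_voltage G z y u ->
  {in gV G, f =1 u}.
Proof.
move=> cl pos /gconnectedP con yV zV /is_voltageP-/(_ cl yV zV)[fz fD].
move=> /is_voltageP-/(_ cl yV zV)[uz uD] x xV.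
set d := fun x => 1 * f x + -1 * u x.
have d0 : dirichlet G d d = 0 by rewrite dirichlet_lin fD uD; ring.
have := grad0_connect (dirichlet_eq0 pos d0) (con x z xV zV).
rewrite /d fz uz; lra.
Qed.

Lemma voltageE G z x y f : closed_edges G -> pos_len G -> gconnected G ->
  y \in gV G -> z \in gV G -> x \in gV G -> is_voltage G z y f ->
  voltage G z x y = f x.
Proof.
move=> cl pos con yV zV xV hf.
apply: (voltage_unique cl pos con yV zV _ hf xV).
by apply: epsilon_spec; exists f.
Qed.

(** The extra [f P] at [P] removes the constants from the kernel; the identity outside [gV G] makes
    this an injective endomorphism of all functions on [T]. *)
Definition grounded_laplacian G (P : T) (f : {ffun T -> R^o}) : {ffun T -> R^o} :=
  [ffun w => if w \in gV G then laplacian G f w + (w == P)%:R * f P else f w].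

Lemma grounded_laplacian_linear G P : linear (grounded_laplacian G P).
Proof.
move=> a f u; apply/ffunP => w; rewrite !ffunE.
case: ifP => _ //.
rewrite !laplacianE.
have -> : dirichlet G (a *: f + u) (fun x => (x == w)%:R) =
  dirichlet G (fun x => a * f x + 1 * u x) (fun x => (x == w)%:R).
  by apply: eq_bigr => e _; rewrite /grad !ffunE mul1r mul1r.
by rewrite dirichlet_lin /GRing.scale /=; ring.
Qed.

HB.instance Definition _ G P :=
  GRing.isLinear.Build R {ffun T -> R^o} {ffun T -> R^o} *:%R
    (grounded_laplacian G P) (grounded_laplacian_linear G P).

Lemma sum_grounded_laplacian G P (f : {ffun T -> R^o}) phi :
  closed_edges G -> P \in gV G ->
  \sum_(w in gV G) phi w * grounded_laplacian G P f w
  = dirichlet G f phi + phi P * f P.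
Proof.
move=> cl PV; rewrite -sum_laplacian // -(sum_mul_eq (fun w => phi w * f P) PV).
rewrite -big_split; apply: eq_bigr => w wV; rewrite ffunE wV /= (eq_sym P).
by ring.
Qed.

(** The grounded Laplacian is injective on a finite-dimensional space, hence invertible. *)
Lemma voltage_exists G z y : closed_edges G -> pos_len G -> gconnected G ->
  y \in gV G -> z \in gV G -> exists f, is_voltage G z y f.
Proof.
move=> cl pos /gconnectedP con yV zV.
pose L := linfun (grounded_laplacian G z).
have kerL : lker L == 0%VS.
  rewrite -subv0; apply/subvP => f; rewrite memv_ker lfunE /= memv0 => /eqP Lf0.
  have eq0 : dirichlet G f f + f z * f z = 0.
    rewrite -sum_grounded_laplacian // big1 // => w _.
    by rewrite Lf0 ffunE mulr0.
  have fz : f z = 0.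
    apply/eqP; rewrite -[_ == 0]orbb -mulf_eq0.
    have := dirichlet_ge0 f pos; have := sqr_ge0 (f z); rewrite expr2.
    by move=> h1 h2; apply/eqP; lra.
  have D0 : dirichlet G f f = 0 by rewrite fz mulr0 addr0 in eq0.
  apply/eqP/ffunP => x; rewrite [RHS]ffunE.
  have [xV|xV] := boolP (x \in gV G).
    by rewrite (grad0_connect (dirichlet_eq0 pos D0) (con x z xV zV)).
  by have := congr1 (fun g : {ffun T -> R^o} => g x) Lf0; rewrite !ffunE (negPf xV).
pose b : {ffun T -> R^o} := [ffun w => (y == w)%:R - (z == w)%:R].
pose f := (L^-1)%VF b.
have Lf : grounded_laplacian G z f = b by have := lker0_lfunVK kerL b; rewrite lfunE.
have Df phi : dirichlet G f phi + phi z * f z = phi y - phi z.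
  rewrite -sum_grounded_laplacian // Lf.
  under eq_bigr => w _ do rewrite ffunE mulrBr mulrC (mulrC (phi w)).
  by rewrite sumrB !sum_mul_eq.
(* The source [b] has total mass 0, so the constant test function leaves only the grounding term. *)
have fz : f z = 0.
  have := Df (fun=> 1); rewrite /dirichlet big1 ?subrr ?add0r ?mul1r //.
  by move=> e _; rewrite /grad subrr mulr0 mul0r.
exists f; apply/is_voltageP => //; split=> // phi.
by have := Df phi; rewrite fz mulr0 addr0.
Qed.

End Dirichlet.

(** * Limits of the edge terms as the resistance tends to infinity, for bridges *)

Section Limits.
Variables (R : realType) (L : R).
Hypothesis L0 : 0 < L.

Lemma cvg_inv_add_pinfty : ((L + r)^-1 @[r --> +oo] --> (0 : R))%classic.
Proof.
have /= := @gtr0_cvgV0 R R (pinfty_nbhs R) _ (fun r => L + r) _.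
move=> H; apply/H; last exact: cvg_addrl.
near=> r; rewrite addr_gt0 //; near: r; exact: nbhs_pinfty_gt.
Unshelve. all: end_near. Qed.

Lemma cvg_ratio_pinfty : (r / (L + r) @[r --> +oo] --> (1 : R))%classic.
Proof.
have : (1 - L * (L + r)^-1 @[r --> +oo] --> (1 - L * 0 : R))%classic.
  by apply: cvgB; [exact: cvg_cst|apply: cvgM; [exact: cvg_cst|exact: cvg_inv_add_pinfty]].
rewrite mulr0 subr0; apply: cvg_trans; apply: near_eq_cvg; near=> r.
have r0 : 0 < r by near: r; exact: nbhs_pinfty_gt.
by field; rewrite lt0r_neq0 // addr_gt0.
Unshelve. all: end_near. Qed.

(** The sign enters only squared, so the coefficients 1/4 and 3/4 add up to 1. For [xterm] below,
    the two 3/4 terms cancel instead. *)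
Lemma cvg_yterm_pinfty s : s ^+ 2 = 1 ->
  (yterm L r (s * r) @[r --> +oo] --> L)%classic.
Proof.
move=> s2.
have -> : (fun r => yterm L r (s * r))
    = (fun r => L * ((r / (L + r)) * (r / (L + r)))).
  by apply/funext => r; rewrite /yterm exprMn s2 -exprVn; move: (L + r)^-1 => z; field.
rewrite -[X in (_ --> X)%classic]mulr1 -[X in L * X]mulr1.
by apply: cvgM; [exact: cvg_cst|apply: cvgM; exact: cvg_ratio_pinfty].
Qed.

Lemma cvg_xterm_pinfty s : s ^+ 2 = 1 ->
  (xterm L r (s * r) @[r --> +oo] --> (0 : R))%classic.
Proof.
move=> s2.
have -> : (fun r => xterm L r (s * r))
    = (fun r => L ^+ 2 * ((L + r)^-1 * (r / (L + r)))).
  by apply/funext => r; rewrite /xterm exprMn s2 -exprVn; ring.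
rewrite -[X in (_ --> X)%classic](mulr0 (L ^+ 2)) -[X in _ * X](mul0r 1).
apply: cvgM; first exact: cvg_cst.
by apply: cvgM; [exact: cvg_inv_add_pinfty|exact: cvg_ratio_pinfty].
Qed.

End Limits.

(** * Green kernel and edge potentials *)

Section Green.
Variables (R : realType) (T E : finType).
Implicit Types (G : mgraph R T E) (f u phi : T -> R) (g : T -> T -> R).

(* [g y x] is the potential at [x] when a unit current enters at [y] and exits
   at the ground [P]. *)
Definition green G (P : T) g : Prop :=
  forall y, y \in gV G ->
    g y P = 0 /\ forall phi, dirichlet G (g y) phi = phi y - phi P.

Lemma green_exists G P : metrized G -> P \in gV G -> exists g, green G P g.
Proof.
case=> _ cl pos con PV.
exists (fun y => epsilon (inhabits (fun=> 0)) (is_voltage G P y)) => y yV.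
by apply/is_voltageP => //; apply: epsilon_spec; apply: voltage_exists.
Qed.

(** Reciprocity: the energy pairing of [g x] and [g y] can be evaluated from either side. *)
Lemma green_sym G P g x y : green G P g -> x \in gV G -> y \in gV G ->
  g x y = g y x.
Proof.
move=> gr xV yV; have [gxP gxD] := gr x xV; have [gyP gyD] := gr y yV.
by have := gxD (g y); rewrite dirichletC gyD gxP gyP !subr0.
Qed.

(** For a Green kernel, the potential of a unit current sent through the whole graph from source to
    target of [i]. *)
Definition edge_pot G g (i : E) (x : T) : R := g (gsrc G i) x - g (gtgt G i) x.

(* The effective resistance between the end points of [i] when [k] is a Green
   kernel. *)
Definition edge_res G (k : T -> T -> R) (i : E) : R :=
  k (gsrc G i) (gsrc G i) - k (gsrc G i) (gtgt G i)
  - k (gtgt G i) (gsrc G i) + k (gtgt G i) (gtgt G i).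

Lemma grad_edge_pot G g i : grad G i (edge_pot G g i) = edge_res G g i.
Proof. by rewrite /grad /edge_pot /edge_res; ring. Qed.

Lemma dirichlet_affine G (a b : R) f phi :
  dirichlet G (fun x => a * f x + b) phi = a * dirichlet G f phi.
Proof.
rewrite /dirichlet mulr_sumr; apply: eq_bigr => e _; rewrite /grad; ring.
Qed.

Variables (G : mgraph R T E) (P : T) (g : T -> T -> R).
Hypotheses (metG : metrized G) (PV : P \in gV G) (grG : green G P g).

Local Notation h := (edge_pot G g).
Local Notation res := (edge_res G g).

Let cl : closed_edges G. Proof. by case: metG. Qed.
Let pos : pos_len G. Proof. by case: metG. Qed.

Lemma dirichlet_edge_pot i phi : i \in gE G ->
  dirichlet G (h i) phi = grad G i phi.
Proof.
move=> iE; have [sV tV] := cl iE.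
transitivity (dirichlet G (fun x => 1 * g (gsrc G i) x + -1 * g (gtgt G i) x) phi).
  by apply: eq_bigr => e _; rewrite /grad /edge_pot; ring.
by rewrite dirichlet_lin (grG sV).2 (grG tV).2 /grad; ring.
Qed.

Lemma edge_pot_ground i : i \in gE G -> h i P = 0.
Proof.
by move=> /cl[sV tV]; rewrite /edge_pot (grG sV).1 (grG tV).1 subrr.
Qed.

(** * Edge deletion: the resistances of the deleted graph and the bridges, in terms of the Green
    kernel *)

Lemma gdelete_closed i : closed_edges (gdelete G i).
Proof. by move=> e /setD1P[_ /cl]. Qed.

Lemma gdelete_pos i : pos_len (gdelete G i).
Proof. by move=> e /setD1P[_ /pos]. Qed.

(** Of the unit current, [i] itself carries the fraction [res i / glen G i]; the factor
    [1 - res i / glen G i] is what flows through the rest of the graph. *)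
Lemma energy_delete i : i \in gE G ->
  dirichlet (gdelete G i) (h i) (h i) = res i * (1 - res i / glen G i).
Proof.
move=> iE; rewrite dirichlet_delete // dirichlet_edge_pot // grad_edge_pot.
by ring.
Qed.

Section NonBridge.
Variable i : E.
Hypotheses (iE : i \in gE G) (nbr : ~~ is_bridge G i).

(** Otherwise [h i] has no energy in the connected deleted graph, so it is equal at both ends of
    [i]; then [res i = 0] and the factor would be 1. *)
Lemma nonbridge_neq0 : 1 - res i / glen G i != 0.
Proof.
apply/negP => /eqP c0.
have con : gconnected (gdelete G i) by move: nbr; rewrite negbK.
have [sV tV] := cl iE.
have e0 : dirichlet (gdelete G i) (h i) (h i) = 0 by rewrite energy_delete // c0 mulr0.
have := grad0_connect (dirichlet_eq0 (@gdelete_pos i) e0)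
  (gconnectedP _ con _ _ sV tV).
move/eqP; rewrite -subr_eq0 -/(grad G i (h i)) grad_edge_pot => /eqP r0.
by move: c0; rewrite r0 mul0r subr0 => /eqP; rewrite oner_eq0.
Qed.

(* [b] tells whether the current runs from source to target of [i] or backwards. *)
Lemma voltage_delete z y x (b : bool) :
  (if b then (y, z) else (z, y)) = (gsrc G i, gtgt G i) -> x \in gV G ->
  voltage (gdelete G i) z x y
  = (-1) ^+ (~~ b) * (h i x - h i z) / (1 - res i / glen G i).
Proof.
move=> yz xV; have [sV tV] := cl iE.
have con : gconnected (gdelete G i) by move: nbr; rewrite negbK.
have [yV zV] : y \in gV G /\ z \in gV G by case: b yz => -[-> ->].
set c := 1 - _; have c0 : c != 0 := nonbridge_neq0.
pose a := (-1) ^+ (~~ b) / c.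
have -> : (-1) ^+ (~~ b) * (h i x - h i z) / c = a * h i x + - (a * h i z).
  by rewrite /a; ring.
apply: (@voltageE _ _ _ _ _ _ _ (fun x => a * h i x + - (a * h i z))) => //.
- exact: gdelete_closed.
- exact: gdelete_pos.
apply/is_voltageP => //; first exact: gdelete_closed.
split=> [|phi]; first by rewrite subrr.
rewrite dirichlet_affine dirichlet_delete // dirichlet_edge_pot // grad_edge_pot.
have -> : grad G i phi - res i * grad G i phi / glen G i = c * grad G i phi.
  by rewrite /c; ring.
rewrite /a -mulrA mulKf // /grad.
by case: b yz {a} => -[-> ->] /=; ring.
Qed.

(** The parallel law 1/r = 1/L + 1/R solved for R, in a form that also covers self-loops. *)
Lemma Rres_nonbridge : Rres G i = res i / (1 - res i / glen G i).
Proof.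
have [sV tV] := cl iE.
rewrite /Rres (@voltage_delete _ _ _ true) // mul1r -/(grad G i (h i)).
by rewrite grad_edge_pot.
Qed.

Lemma Ra_sub_Rb_nonbridge p : p \in gV G ->
  Ra G i p - Rb G i p =
  (h i (gsrc G i) + h i (gtgt G i) - 2 * h i p) / (1 - res i / glen G i).
Proof.
move=> pV; rewrite /Ra (@voltage_delete _ _ _ false) // /Rb.
by rewrite (@voltage_delete _ _ _ true) //= expr1 expr0; ring.
Qed.

End NonBridge.

(** Across a bridge, [h i] is, up to a constant, [glen G i] times the indicator [phi] of the source
    side. *)
Lemma bridge_potential i : i \in gE G -> is_bridge G i ->
  res i = glen G i /\
  forall p, p \in gV G ->
    h i (gsrc G i) + h i (gtgt G i) - 2 * h i p = bridge_sign G i p * glen G i.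
Proof.
move=> iE br; have [sV tV] := cl iE; have L0 := pos iE.
have conG : gconnected G by case: metG.
pose S x := connect (gadj (gdelete G i)) (gsrc G i) x.
pose phi x : R := (S x)%:R.
(* If the target were reachable without [i], every use of [i] in a path could be bypassed and [i]
   would not be a bridge. *)
have St : S (gtgt G i) = false.
  apply/negP => st; move/negP: br; apply; apply/gconnectedP => x y xV yV.
  have := gconnectedP _ conG _ _ xV yV.
  apply: connect_sub => {xV yV} {}x {}y /existsP[e /andP[eE exy]].
  have [ei|ei] := eqVneq e i.
    case/orP: exy => /andP[/eqP<- /eqP<-]; rewrite ei //.
    by rewrite gadj_connect_sym.
  apply: connect1; apply/existsP; exists e.
  by rewrite in_setD1 ei eE.
have phi0 e : e \in gE (gdelete G i) -> grad G e phi = 0.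
  move=> eE; rewrite /grad /phi /S.
  rewrite (@same_connect_r _ _ (@gadj_connect_sym _ _ _ _) (gsrc G e) (gtgt G e)).
    by rewrite subrr.
  by apply: connect1; apply/existsP; exists e; rewrite eE !eqxx.
have phi1 : grad G i phi = 1 by rewrite /grad /phi St /S connect0 subr0.
(* In the pairing of [h i] with [phi] only the edge [i] contributes. *)
have resL : res i = glen G i.
  have := dirichlet_edge_pot phi iE; rewrite phi1.
  rewrite /dirichlet (big_setD1 i iE) big1 => [|e eE]; last first.
    by rewrite (phi0 _ eE) mulr0 mul0r.
  rewrite /= addr0 phi1 mulr1 grad_edge_pot => /eqP.
  by rewrite -subr_eq0 -[X in _ - X](divff (lt0r_neq0 L0)) -mulrBl mulf_eq0
     invr_eq0 (gt_eqF L0) orbF subr_eq0 => /eqP.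
split=> // p pV.
have hgrad e : e \in gE (gdelete G i) -> grad G e (h i) = 0.
  have := @dirichlet_eq0 _ _ _ (gdelete G i) (h i) (@gdelete_pos i).
  by rewrite energy_delete // resL divff ?lt0r_neq0 // subrr mulr0 => /(_ erefl) /[apply].
pose psi x := h i x + - (glen G i * phi x).
have psi0 e : e \in gE G -> grad G e psi = 0.
  move=> eE; have -> : grad G e psi = grad G e (h i) - glen G i * grad G e phi.
    by rewrite /grad /psi; ring.
  have [->|ei] := eqVneq e i; first by rewrite grad_edge_pot resL phi1; ring.
  have eE' : e \in gE (gdelete G i) by rewrite in_setD1 ei.
  by rewrite hgrad // phi0 //; ring.
have := grad0_connect psi0 (gconnectedP _ conG _ _ pV tV).
have := psi0 i iE; rewrite /grad /psi /bridge_sign -/(S p) /phi St /S connect0.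
by case: (connect _ _ p) => /= *; lra.
Qed.


(* For a Green kernel [k], [ysum k] is y(Gamma) and [rsum k] is
   x(Gamma) + y(Gamma). *)
Definition ysum (k : T -> T -> R) : R :=
  \sum_(e in gE G)
     (4^-1 * (edge_res G k e ^+ 2 / glen G e)
      + 3 / 4 * (grad G e (fun x => k x x) ^+ 2 / glen G e)).

Definition rsum (k : T -> T -> R) : R := \sum_(e in gE G) edge_res G k e.

(** With [c = 1 - res i / glen G i], R = r/c and L + R = L/c, so [c] cancels; at a bridge r = L
    gives the limit 1. *)
Lemma weightE i : i \in gE G -> weight G i = res i / glen G i.
Proof.
move=> iE; have L0 := pos iE; rewrite /weight; case: ifPn => br.
  have [-> _] := bridge_potential iE br.
  rewrite divff ?lt0r_neq0 //; apply: cvg_lim => //; exact: cvg_ratio_pinfty.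
have c0 := nonbridge_neq0 iE br.
rewrite /wterm Rres_nonbridge //; set c := 1 - _ in c0 *.
have -> : res i = glen G i - c * glen G i.
  by rewrite /c; field; rewrite lt0r_neq0.
by field; rewrite c0 /= ?lt0r_neq0 //= addrC subrK lt0r_neq0.
Qed.

(** Off the bridges the factors [c] cancel as in [weightE]. At a bridge r = L and the gap is L up to
    sign, which gives the limits L and 0. *)
Lemma edge_termE i p : i \in gE G -> p \in gV G ->
  let y := 4^-1 * (res i ^+ 2 / glen G i) +
    3 / 4 * ((h i (gsrc G i) + h i (gtgt G i) - 2 * h i p) ^+ 2 / glen G i) in
  edge_term (@yterm R) G i p = y /\ edge_term (@xterm R) G i p = res i - y.
Proof.
move=> iE pV /=; have L0 := pos iE; rewrite /edge_term; case: ifPn => br.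
  have [-> hp] := bridge_potential iE br; rewrite {}hp //.
  have s2 : bridge_sign G i p ^+ 2 = 1 :> R.
    by rewrite /bridge_sign; case: ifP => _; rewrite ?sqrrN expr1n.
  rewrite exprMn s2 mul1r; set s := bridge_sign G i p in s2 *.
  split; apply: cvg_lim => //.
  - rewrite [X in (_ --> X)%classic](_ : _ = glen G i); last first.
      by field; rewrite lt0r_neq0.
    exact: cvg_yterm_pinfty.
  - rewrite [X in (_ --> X)%classic](_ : _ = 0); last first.
      by field; rewrite lt0r_neq0.
    exact: cvg_xterm_pinfty.
have c0 := nonbridge_neq0 iE br.
rewrite Rres_nonbridge // Ra_sub_Rb_nonbridge //.
set c := 1 - _ in c0 *; set D := _ - 2 * _.
have resE : res i = glen G i - c * glen G i.
  by rewrite /c; field; rewrite lt0r_neq0.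
rewrite /yterm /xterm resE.
by split; field; rewrite c0 /= ?lt0r_neq0 //= addrC subrK lt0r_neq0.
Qed.

(** * Independence of the base vertex; x and y as Green kernel sums *)

Lemma edge_pot_add i : i \in gE G ->
  h i (gsrc G i) + h i (gtgt G i) = grad G i (fun x => g x x).
Proof.
move=> iE; have [sV tV] := cl iE.
by rewrite /edge_pot /grad (green_sym grG sV tV); ring.
Qed.

(** By reciprocity the left side is the energy of f - 2 g(p,.) with f(x) = g(x,x). The cross term -4
    f(p) cancels against the energy 4 g(p,p). *)
Lemma sum_endpoint_gap p : p \in gV G ->
  \sum_(i in gE G)
     (h i (gsrc G i) + h i (gtgt G i) - 2 * h i p) ^+ 2 / glen G i
  = \sum_(i in gE G) grad G i (fun x => g x x) ^+ 2 / glen G i.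
Proof.
move=> pV; pose f x := g x x; pose u x := 1 * f x + -2 * g p x.
transitivity (dirichlet G u u).
  apply: eq_bigr => i iE; have [sV tV] := cl iE.
  rewrite edge_pot_add // /edge_pot /grad /u /f.
  by rewrite (green_sym grG sV pV) (green_sym grG tV pV); ring.
transitivity (dirichlet G f f); last by apply: eq_bigr => i _; rewrite -expr2.
rewrite dirichlet_lin (dirichletC _ f) (dirichletC _ (g p) u) !dirichlet_lin.
rewrite (dirichletC _ f (g p)) !(grG pV).2 (grG pV).1 /f (grG PV).1; ring.
Qed.

Lemma ypE p : p \in gV G -> yp G p = ysum g.
Proof.
move=> pV; rewrite /yp /ysum big_split /= -!mulr_sumr -(sum_endpoint_gap pV).
rewrite !mulr_sumr -big_split; apply: eq_bigr => i iE.
by have [-> _] := edge_termE iE pV.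
Qed.

Lemma xpE p : p \in gV G -> xp G p = rsum g - ysum g.
Proof.
move=> pV; rewrite -(ypE pV) -sumrB; apply: eq_bigr => i iE.
by have [-> ->] := edge_termE iE pV.
Qed.

Lemma ygE : yg G = ysum g.
Proof.
rewrite /yg; case: pickP => [p pV|/(_ P)]; first exact: ypE.
by rewrite PV.
Qed.

Lemma xgE : xg G = rsum g - ysum g.
Proof.
rewrite /xg; case: pickP => [p pV|/(_ P)]; first exact: xpE.
by rewrite PV.
Qed.

(** * Foster's theorem and sums of powers of edge potentials *)

Lemma grad_edge_pot_sym e i : e \in gE G -> i \in gE G ->
  grad G e (h i) = grad G i (h e).
Proof. by move=> eE iE; rewrite -!dirichlet_edge_pot // dirichletC. Qed.

(** A trace computed twice: the Laplacian of [g y] at [y] is 1 except at the ground, where it is 0;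
    regrouped by edges the same sum gives the resistances. *)
Lemma foster : \sum_(i in gE G) res i / glen G i = #|gV G|%:R - 1.
Proof.
have lapg y : y \in gV G -> laplacian G (g y) y = 1 - (P == y)%:R.
  by move=> yV; rewrite laplacianE (grG yV).2 eqxx.
transitivity (\sum_(y in gV G) laplacian G (g y) y); last first.
  rewrite (eq_bigr _ lapg) sumrB sumr_const.
  congr (_ - _); rewrite -[RHS](sum_mul_eq (fun=> 1) PV).
  by apply: eq_bigr => w _; rewrite mulr1.
rewrite /laplacian exchange_big; apply: eq_bigr => e eE /=; have [sV tV] := cl eE.
rewrite -mulr_suml big_split /= (sum_mul_eq (fun y => g y y - g y (gtgt G e))) //.
by rewrite (sum_mul_eq (fun y => g y y - g y (gsrc G e))) // /edge_res; congr (_ / _); ring.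
Qed.

(** Reciprocity turns the sum into the energy of [h e]. *)
Lemma sum_grad_sq e : e \in gE G ->
  \sum_(i in gE G) grad G e (h i) ^+ 2 / glen G i = res e.
Proof.
move=> eE; rewrite -grad_edge_pot -dirichlet_edge_pot //.
by apply: eq_bigr => i iE; rewrite -grad_edge_pot_sym.
Qed.

Lemma sum_edge_pot_sq x : x \in gV G ->
  \sum_(i in gE G) h i x ^+ 2 / glen G i = g x x.
Proof.
move=> xV; have [gP gD] := grG xV.
transitivity (dirichlet G (g x) (g x)); last by rewrite gD gP subr0.
apply: eq_bigr => i iE; have [sV tV] := cl iE.
by rewrite /edge_pot /grad (green_sym grG sV xV) (green_sym grG tV xV).
Qed.

(** Linearity in the second argument, with [sum_edge_pot_sq] applied at both ends of each edge. *)
Lemma sum_dirichlet_edge_pot_sq f :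
  \sum_(i in gE G) dirichlet G f (fun x => h i x ^+ 2) / glen G i
  = dirichlet G f (fun x => g x x).
Proof.
under eq_bigr do rewrite mulr_suml.
rewrite exchange_big; apply: eq_bigr => e eE /=; have [sV tV] := cl eE.
rewrite [X in _ = _ * X / _]/grad -!sum_edge_pot_sq // -sumrB mulr_sumr mulr_suml.
by apply: eq_bigr => i _; rewrite /grad; ring.
Qed.

(* The current [h i] has sources only at the end points of [i]; pairing it with
   its cube and using
   (a^3 - b^3) (a - b) = 3/4 (a^2 - b^2)^2 + 1/4 (a - b)^4
   evaluates the quartic sums that contraction produces. *)
Lemma edge_pot_cube i : i \in gE G ->
  3 / 4 * dirichlet G (fun x => h i x ^+ 2) (fun x => h i x ^+ 2)
  + 4^-1 * \sum_(e in gE G) grad G e (h i) ^+ 4 / glen G e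
  = res i * (4^-1 * res i ^+ 2 + 3 / 4 * grad G i (fun x => g x x) ^+ 2).
Proof.
move=> iE; rewrite -edge_pot_add // -grad_edge_pot.
transitivity (dirichlet G (h i) (fun x => h i x ^+ 3)).
  rewrite /dirichlet !mulr_sumr -big_split; apply: eq_bigr => e eE /=.
  by rewrite /grad; field; rewrite lt0r_neq0 // pos.
by rewrite dirichlet_edge_pot // /grad; field.
Qed.

(** * Weighted sums over all contracted kernels *)

Lemma edge_res_eq0 i : i \in gE G -> res i = 0 ->
  forall e, e \in gE G -> grad G e (h i) = 0.
Proof.
move=> iE r0; apply: dirichlet_eq0 => //.
by rewrite dirichlet_edge_pot // grad_edge_pot.
Qed.

(** Zero resistance would kill every gradient of [h i], yet pairing [h i] with the indicator of the
    source gives 1. *)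
Lemma edge_res_neq0 i : i \in gE G -> gsrc G i != gtgt G i -> res i != 0.
Proof.
move=> iE st; apply/eqP => r0; have /eqP := oner_neq0 R; apply.
have := dirichlet_edge_pot (fun x => (x == gsrc G i)%:R) iE.
rewrite /grad eqxx eq_sym (negPf st) subr0 => /esym D1; apply: (etrans D1).
by apply: big1 => e eE; rewrite edge_res_eq0 // !mul0r.
Qed.

Lemma edge_res_loop i : gsrc G i = gtgt G i -> res i = 0.
Proof. by rewrite /edge_res => ->; ring. Qed.

(* Green kernel of the graph with [i] contracted: merging its end points amounts
   to adding the multiple of [h i] that equalizes the potential there. *)
Definition contract_kernel i (y x : T) : R := g y x - h i y * h i x / res i.

Lemma edge_res_contract i e : e \in gE G ->
  edge_res G (contract_kernel i) e = res e - grad G e (h i) ^+ 2 / res i.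
Proof. by move=> eE; rewrite /edge_res /contract_kernel /grad; ring. Qed.

(** The weight cancels the division by [res i]. Foster's theorem gives v - 1 copies of [rsum g], and
    the exchanged double sum removes one. *)
Lemma sum_rsum_contract :
  \sum_(i in gE G) res i / glen G i * rsum (contract_kernel i)
  = (#|gV G|%:R - 2) * rsum g.
Proof.
transitivity (\sum_(i in gE G) res i / glen G i * rsum g
  - \sum_(i in gE G) \sum_(e in gE G) grad G e (h i) ^+ 2 / glen G i).
  rewrite -sumrB; apply: eq_bigr => i iE.
  rewrite !mulr_sumr -sumrB; apply: eq_bigr => e eE.
  rewrite edge_res_contract //; have [r0|r0] := eqVneq (res i) 0.
    by rewrite edge_res_eq0 // r0; ring.
  by field; rewrite r0 lt0r_neq0 // pos.
rewrite exchange_big /= (eq_bigr _ sum_grad_sq) -mulr_suml foster -/(rsum g).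
by ring.
Qed.

(** Expansion of the squares in [ysum]. By [edge_pot_cube] the quartic part collapses to the last
    line, which is the term of [i] in [ysum g]. *)
Lemma ysum_contract i : i \in gE G ->
  res i / glen G i * ysum (contract_kernel i)
  = res i / glen G i * ysum g
    - 2^-1 * (\sum_(e in gE G)
                 res e / glen G e * (grad G e (h i) ^+ 2 / glen G i))
    - 3 / 2 * (dirichlet G (fun x => g x x) (fun x => h i x ^+ 2) / glen G i)
    + (4^-1 * (res i ^+ 2 / glen G i)
       + 3 / 4 * (grad G i (fun x => g x x) ^+ 2 / glen G i)).
Proof.
move=> iE; have L0 := lt0r_neq0 (pos iE).
have [st|st] := eqVneq (gsrc G i) (gtgt G i).
  have h0 x : h i x = 0 by rewrite /edge_pot st subrr.
  rewrite -edge_pot_add // !h0 (edge_res_loop st).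
  rewrite dirichletC [dirichlet _ _ _]big1 => [|e _]; last by rewrite /grad !h0; ring.
  rewrite big1 => [|e _]; last by rewrite /grad !h0; ring.
  by ring.
have r0 := edge_res_neq0 iE st.
have -> : 4^-1 * (res i ^+ 2 / glen G i)
    + 3 / 4 * (grad G i (fun x => g x x) ^+ 2 / glen G i)
  = (3 / 4 * dirichlet G (fun x => h i x ^+ 2) (fun x => h i x ^+ 2)
     + 4^-1 * \sum_(e in gE G) grad G e (h i) ^+ 4 / glen G e)
    / (res i * glen G i).
  by rewrite edge_pot_cube //; field; rewrite r0 L0.
rewrite /ysum /dirichlet !(mulr_sumr, mulr_suml) -!sumrB -!big_split /=.
rewrite mulr_suml -big_split; apply: eq_bigr => e eE /=.
rewrite edge_res_contract // /contract_kernel /grad.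
by field; rewrite r0 L0 lt0r_neq0 // pos.
Qed.

(** Foster's theorem gives (v - 1) y, the two cross terms sum to -2 y, and the quartic parts restore
    one y. *)
Lemma sum_ysum_contract :
  \sum_(i in gE G) res i / glen G i * ysum (contract_kernel i)
  = (#|gV G|%:R - 2) * ysum g.
Proof.
rewrite (eq_bigr _ ysum_contract) big_split /= !sumrB -/(ysum g).
rewrite -mulr_suml foster -!mulr_sumr sum_dirichlet_edge_pot_sq exchange_big /=.
have -> : \sum_(e in gE G) \sum_(i in gE G)
    res e / glen G e * (grad G e (h i) ^+ 2 / glen G i)
  = \sum_(e in gE G) res e ^+ 2 / glen G e.
  by apply: eq_bigr => e eE; rewrite -mulr_sumr sum_grad_sq //; ring.
have : ysum g = 4^-1 * (\sum_(e in gE G) res e ^+ 2 / glen G e)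
    + 3 / 4 * dirichlet G (fun x => g x x) (fun x => g x x).
  rewrite /ysum /dirichlet !mulr_sumr -big_split; apply: eq_bigr => e _ /=.
  by rewrite expr2.
by lra.
Qed.

End Green.

(** * The contracted graph and its Green kernel, for an edge that is not a self-loop *)

Section Contraction.
Variables (R : realType) (T E : finType) (G : mgraph R T E) (i : E).
Hypotheses (metG : metrized G) (iE : i \in gE G) (st : gsrc G i != gtgt G i).

Let cl : closed_edges G. Proof. by case: metG. Qed.
Let pos : pos_len G. Proof. by case: metG. Qed.

Definition merge (x : T) : T := if x == gtgt G i then gsrc G i else x.

Lemma merge_in x : x \in gV G -> merge x \in gV (gcontract G i).
Proof.
have [sV _] := cl iE; rewrite /merge /= (negPf st) in_setD1.
by case: (eqVneq x (gtgt G i)) => [_ _|-> ->]; rewrite ?st.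
Qed.

Lemma gcontractV x : x \in gV (gcontract G i) -> x \in gV G /\ merge x = x.
Proof.
by rewrite /merge /= (negPf st) in_setD1 => /andP[/negPf-> ->].
Qed.

(** For connectivity, a path is pushed through [merge]; its steps along [i] collapse to a point. *)
Lemma metrized_gcontract : metrized (gcontract G i).
Proof.
have [/set0Pn[x xV] _ _ con] := metG; split.
- by apply/set0Pn; exists (merge x); apply: merge_in.
- by move=> e /setD1P[_ /cl[sV tV]]; split; apply: merge_in.
- by move=> e /setD1P[_ /pos].
apply/gconnectedP => u w /gcontractV[uV <-] /gcontractV[wV <-].
have /connectP[p] := gconnectedP _ con u w uV wV.
elim: p u {uV} => [|z p IH] u /=; first by move=> _ ->; apply: connect0.
case/andP=> /existsP[e /andP[eE euz]] pz wl.
apply: connect_trans (IH z pz wl).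
have [ei|ei] := eqVneq e i.
  have -> : merge u = merge z; last exact: connect0.
  by case/orP: euz => /andP[/eqP<- /eqP<-]; rewrite ei /merge eqxx (negPf st).
apply: connect1; apply/existsP; exists e; rewrite in_setD1 ei eE /=.
by case/orP: euz => /andP[/eqP<- /eqP<-]; rewrite !eqxx ?orbT.
Qed.

Variables (P : T) (g : T -> T -> R).
Hypotheses (PV : P \in gV G) (grG : green G P g).

Local Notation k := (contract_kernel G g i).

(** Across [i], [g y] jumps by [h i y] and [h i] by [res i], so the correction cancels the jump;
    symmetry handles the other argument. *)
Lemma contract_kernel_merge x y : x \in gV G -> y \in gV G ->
  k (merge y) (merge x) = k y x.
Proof.
move=> xV yV; have [sV tV] := cl iE.
have r0 := edge_res_neq0 metG grG iE st.
have sym := green_sym grG.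
rewrite /merge; do 2!case: eqVneq => [->|_] //;
  rewrite /contract_kernel /edge_pot ?(sym _ _ tV sV) ?(sym _ _ xV sV)
   ?(sym _ _ xV tV) ?(sym _ _ yV sV) ?(sym _ _ yV tV);
  move: r0; rewrite /edge_res (sym _ _ tV sV) => r0; field; by [].
Qed.

(** Test functions are pulled back along [merge]. Removing [i] costs nothing because [k y] has no
    jump there, and the [h i] correction pairs to 0 because the pullback has none either. *)
Lemma green_contract : green (gcontract G i) (merge P) k.
Proof.
move=> y /gcontractV[yV my]; have [sV tV] := cl iE.
have kym x : x \in gV G -> k y (merge x) = k y x.
  by move=> xV; rewrite -{1}my contract_kernel_merge.
split.
  rewrite kym // /contract_kernel.
  by rewrite (edge_pot_ground metG grG iE) (grG yV).1; ring.
move=> phi; pose psi x := phi (merge x).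
have psi_st : grad G i psi = 0.
  by rewrite /grad /psi /merge eqxx (negPf st) subrr.
have ky_st : grad G i (k y) = 0.
  by rewrite /grad -(kym _ sV) -(kym _ tV) /merge eqxx (negPf st) subrr.
transitivity (dirichlet (gdelete G i) (k y) psi).
  apply: eq_bigr => e /setD1P[_ /cl[esV etV]]; rewrite /grad /= -!/(merge _).
  by rewrite !kym.
rewrite dirichlet_delete // ky_st !mul0r subr0.
transitivity (dirichlet G (fun x => 1 * g y x
                 + - (edge_pot G g i y / edge_res G g i) * edge_pot G g i x) psi).
  by apply: eq_bigr => e _; rewrite /grad /contract_kernel; ring.
rewrite dirichlet_lin (dirichlet_edge_pot metG grG) // psi_st (grG yV).2 /psi my.
by ring.
Qed.

Lemma edge_res_gcontract e : e \in gE G ->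
  edge_res (gcontract G i) k e = edge_res G k e.
Proof.
move=> /cl[sV tV].
by rewrite /edge_res /= -!/(merge _) !contract_kernel_merge.
Qed.

Lemma grad_diag_gcontract e : e \in gE G ->
  grad (gcontract G i) e (fun x => k x x) = grad G e (fun x => k x x).
Proof.
by move=> /cl[sV tV]; rewrite /grad /= -!/(merge _) !contract_kernel_merge.
Qed.

(** The end-point maps of [gcontract] turn [i] into a loop, so its term vanishes and sums over the
    remaining edges extend to all of [gE G]. *)
Lemma edge_res_contracted : edge_res G k i = 0.
Proof.
rewrite -edge_res_gcontract // /edge_res /= eqxx (negPf st); ring.
Qed.

Lemma grad_diag_contracted : grad G i (fun x => k x x) = 0.
Proof.
by rewrite -grad_diag_gcontract // /grad /= eqxx (negPf st) subrr.
Qed.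

Lemma rsum_gcontract : rsum (gcontract G i) k = rsum G k.
Proof.
rewrite [RHS]/rsum (big_setD1 i iE) /= edge_res_contracted add0r.
by apply: eq_bigr => e /setD1P[_ eE]; rewrite edge_res_gcontract.
Qed.

Lemma ysum_gcontract : ysum (gcontract G i) k = ysum G k.
Proof.
rewrite [RHS]/ysum (big_setD1 i iE) /= edge_res_contracted grad_diag_contracted.
rewrite expr0n /= !mul0r !mulr0 !add0r.
apply: eq_bigr => e /setD1P[_ eE].
by rewrite edge_res_gcontract // grad_diag_gcontract.
Qed.

Lemma xg_ygE_gcontract :
  xg (gcontract G i) = rsum G k - ysum G k /\ yg (gcontract G i) = ysum G k.
Proof.
have m := metrized_gcontract; have PV' := merge_in PV; have gr := green_contract.
by rewrite (xgE m PV' gr) (ygE m PV' gr) rsum_gcontract ysum_gcontract.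
Qed.

End Contraction.

Theorem theorem3p9 (R : realType) (T E : finType) (G : mgraph R T E) :
  metrized G ->
  (#|gV G|%:R - 2) * xg G = \sum_(i in gE G) weight G i * xg (gcontract G i) /\
  (#|gV G|%:R - 2) * yg G = \sum_(i in gE G) weight G i * yg (gcontract G i).
Proof.
move=> metG; have [/set0Pn[P PV] _ _ _] := metG.
have [g grG] := green_exists metG PV.
have key i : i \in gE G ->
    weight G i * xg (gcontract G i) = edge_res G g i / glen G i *
      (rsum G (contract_kernel G g i) - ysum G (contract_kernel G g i)) /\
    weight G i * yg (gcontract G i) = edge_res G g i / glen G i *
      ysum G (contract_kernel G g i).
  move=> iE; rewrite (weightE metG grG iE).
  (* A self-loop has weight 0, so both sides vanish whatever its contraction is. *)
  have [loop|st] := eqVneq (gsrc G i) (gtgt G i).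
    by rewrite edge_res_loop // !mul0r.
  by have [-> ->] := xg_ygE_gcontract metG iE st PV grG.
rewrite (xgE metG PV grG) (ygE metG PV grG).
rewrite (eq_bigr _ (fun i iE => (key i iE).1)) (eq_bigr _ (fun i iE => (key i iE).2)).
rewrite (sum_ysum_contract metG PV grG); split=> //.
under eq_bigr do rewrite mulrBr.
by rewrite sumrB (sum_ysum_contract metG PV grG) (sum_rsum_contract metG PV grG) mulrBr.
Qed.
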